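(* Fix $\lambda\in\mathbb R$, $0<a<b<\infty$ and $R_0\in\mathbb Z_{\ge0}$, and put $K_0=[a,b]\times\{0,\dots,R_0\}$. There are positive constants $A_-,A_+,B_-,B_+$, depending on $K_0$ and $\lambda$, such that $$A_-^q e^{-B_-q^3}\le\alpha_\lambda^{(q)}(K_0^q)\le A_+^q e^{-B_+q^3},\qquad q\ge1.$$ Consequently, the power $q^3$ in the uniform finite $n$ estimate $\mathbb E[(\Xi_n(K_0))_q]\le C^qe^{-cq^3}$ ($q\ge1$, $n\ge n_\lambda$) cannot be replaced by $q^{3+\varepsilon}$ for any $\varepsilon>0$ while retaining a prefactor exponential in $q$ and constants independent of $n,q$; that is, for no $\varepsilon>0$ do there exist constants $C,c>0$ with $\mathbb E[(\Xi_n(K_0))_q]\le C^qe^{-cq^{3+\varepsilon}}$ for all $q\ge1$ and all $n\ge n_\lambda$.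
   Context: Put $p_n=n^{-1}+\lambda n^{-4/3}$ and let $n_\lambda$ be a fixed integer with $p_n\in(0,1)$ for all $n\ge n_\lambda$. $G(n,p)$ is the Erdős–Rényi random graph, $\mathcal C(G)$ the set of connected components of $G$; for a component $C$, $|C|$ and $e(C)$ are its numbers of vertices and edges, and $\operatorname{sp}(C)=e(C)-|C|+1$. Let $E=(0,\infty)\times\mathbb Z_{\ge0}$ and $\Xi_n=\sum_{C\in\mathcal C(G(n,p_n))}\delta_{(n^{-2/3}|C|,\operatorname{sp}(C))}$. Falling factorial: $(m)_q=m(m-1)\cdots(m-q+1)$. Let $c(k,m)$ be the number of connected labelled simple graphs on $k$ vertices with $m$ edges; the Wright constants $w_r>0$ are defined by $c(k,k+r-1)\sim w_rk^{k+3r/2-2}$ as $k\to\infty$ ($r\ge0$ fixed). Put $F(x,\lambda)=\frac{x^3}{6}-\frac{\lambda x^2}{2}+\frac{\lambda^2x}{2}$, $\rho_r(x)=\frac{w_r}{\sqrt{2\pi}}x^{3r/2-5/2}$ for $x>0$, and $$m_\lambda^{(q)}\bigl((x_1,r_1),\dots,(x_q,r_q)\bigr)=\exp\Bigl\{-F\Bigl(\sum_{i=1}^qx_i,\lambda\Bigr)\Bigr\}\prod_{i=1}^q\rho_{r_i}(x_i).$$ $\alpha_\lambda^{(q)}$ is the measure on $E^q$ with density $m_\lambda^{(q)}$ with respect to Lebesgue measure in each size coordinate and counting measure in each surplus coordinate. *)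

(* Defs.v *)
From HB Require Import structures.
From mathcomp Require Import all_boot all_order all_algebra.
From mathcomp Require Import all_classical all_reals all_analysis.
Set Implicit Arguments.
Unset Strict Implicit.
Unset Printing Implicit Defensive.
Import Order.TTheory GRing.Theory Num.Theory.
Import numFieldNormedType.Exports.
Local Open Scope classical_set_scope.
Local Open Scope ring_scope.

Definition pairs (n : nat) : {set {set 'I_n}} := [set e : {set 'I_n} | #|e| == 2%N]%SET.

Definition sgraph (n : nat) := {G : {set {set 'I_n}} | G \subset pairs n}.

Section Graph.
Variables (n : nat) (G : sgraph n).

Definition edges : {set {set 'I_n}} := val G.

Definition adj : rel 'I_n := fun x y => [set x; y]%SET \in edges.

Definition components : {set {set 'I_n}} :=
  equivalence_partition (connect adj) [set: 'I_n]%SET.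

Definition nb_edges (C : {set 'I_n}) : nat :=
  #|[set e in edges | e \subset C]%SET|.

(* The truncated subtraction never truncates on a connected component, where
   e(C) + 1 >= |C|. *)
Definition surplus (C : {set 'I_n}) : nat := ((nb_edges C).+1 - #|C|)%N.

Definition connected_graph : bool := #|components| == 1%N.

End Graph.

Definition nb_connected (k m : nat) : nat :=
  #|[set G : sgraph k | connected_graph G & #|edges G| == m]%SET|.

Section RandomGraph.
Variable R : realType.

Definition gnp_prob (n : nat) (p : R) (G : sgraph n) : R :=
  \prod_(e in pairs n) (if e \in edges G then p else 1 - p).

Definition gnp_expectation (n : nat) (p : R) (X : sgraph n -> R) : R :=
  \sum_(G : sgraph n) gnp_prob p G * X G.

Definition pcrit (lambda : R) (n : nat) : R :=
  n%:R^-1 + lambda * n%:R `^ (- (4 / 3)).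

(* The number of atoms in K of the sum of the Dirac masses at the points
   (n^(-2/3) |C|, sp C), C ranging over the components of G. *)
Definition Xi (n : nat) (G : sgraph n) (K : set (R * nat)) : nat :=
  (\sum_(C in components G)
    (((n%:R `^ (- (2 / 3)) * #|C|%:R)%R, surplus G C) \in K))%N.

Definition Xi_factorial_moment (lambda : R) (n q : nat) (K : set (R * nat)) :
  R := gnp_expectation (pcrit lambda n) (fun G : sgraph n => ((Xi G K) ^_ q)%:R).

(* For k >= 1 the truncated k + r - 1 is the usual one. *)
Definition wright_constants (w : nat -> R) : Prop :=
  forall r : nat, 0 < w r /\
    (nb_connected k (k + r - 1))%:R
      / (w r * k%:R `^ (k%:R + 3 * r%:R / 2 - 2)) @[k --> \oo] --> (1 : R).

End RandomGraph.

(* The library's sigma-finite instance on the product measure is shadowed by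
   its subprobability one, hence this restatement. *)
Lemma product_sigma_finite d1 d2 (T1 : measurableType d1)
    (T2 : measurableType d2) (R : realType)
    (m1 : {sigma_finite_measure set T1 -> \bar R})
    (m2 : {sigma_finite_measure set T2 -> \bar R}) :
  sigma_finite setT (m1 \x m2)%E.
Proof.
have /sigma_finiteP[F [TF ndF Foo]] := sigma_finiteT m1.
have /sigma_finiteP[G [TG ndG Goo]] := sigma_finiteT m2.
exists (fun n => F n `*` G n).
  rewrite -setXTT TF TG predeqE => -[x y]; split.
    move=> [/= [n _ Fnx] [k _ Gky]]; exists (maxn n k) => //; split.
    - by move: x Fnx; exact/subsetPset/ndF/leq_maxl.
    - by move: y Gky; exact/subsetPset/ndG/leq_maxr.
  by move=> [n _ []/= ? ?]; split; exists n.
move=> k; have [? ?] := Foo k; have [? ?] := Goo k.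
split; first exact: measurableX.
by rewrite product_measure1E// lte_mul_pinfty// ge0_fin_numE.
Qed.

Section TuplePower.
Local Open Scope ereal_scope.
Context d (T : measurableType d) (R : realType).
Variable mu : {sigma_finite_measure set T -> \bar R}.

Definition tuple_cons (q : nat) (z : T * q.-tuple T) : q.+1.-tuple T :=
  [tuple of z.1 :: z.2].

Lemma measurable_tuple_cons (q : nat) :
  measurable_fun [set: T * q.-tuple T] (@tuple_cons q).
Proof. exact: measurable_cons. Qed.

Section Step.
Variables (q : nat) (nu : {sigma_finite_measure set (q.-tuple T) -> \bar R}).

Definition cons_measure : set (q.+1.-tuple T) -> \bar R :=
  pushforward (mu \x nu) (@tuple_cons q).

Let cons_measure0 : cons_measure set0 = 0.
Proof. by rewrite /cons_measure /pushforward preimage_set0 measure0. Qed.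

Let cons_measure_ge0 A : 0 <= cons_measure A.
Proof. exact: (measure_ge0 (mu \x nu)). Qed.

Let cons_measure_sigma_additive : semi_sigma_additive cons_measure.
Proof.
move=> F mF tF mUF; rewrite /cons_measure /pushforward preimage_bigcup.
have mpre A : measurable A -> measurable (@tuple_cons q @^-1` A).
  by move=> mA; rewrite -[X in measurable X]setTI; exact: measurable_tuple_cons.
apply: measure_semi_sigma_additive.
- by move=> n; exact: mpre.
- apply/trivIsetP => /= i j _ _ ij; rewrite -preimage_setI.
  by move/trivIsetP : tF => /(_ _ _ _ _ ij) ->//; rewrite preimage_set0.
- by rewrite -preimage_bigcup; exact: mpre.
Qed.

HB.instance Definition _ := isMeasure.Build _ _ _ cons_measure
  cons_measure0 cons_measure_ge0 cons_measure_sigma_additive.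

Let cons_measure_sigma_finite : sigma_finite setT cons_measure.
Proof.
have [F UF Foo] := product_sigma_finite mu nu.
pose g (t : q.+1.-tuple T) : T * q.-tuple T := (thead t, [tuple of behead t]).
have gK t : tuple_cons (g t) = t by rewrite /tuple_cons /= -tuple_eta.
have consK z : g (tuple_cons z) = z.
  by case: z => x t; congr pair; apply: val_inj.
have mg : measurable_fun setT g.
  apply/measurable_fun_pairP; split => /=.
    exact: (measurable_tnth ord0).
  exact: measurable_behead.
exists (fun i => g @^-1` F i).
  by apply/esym/seteqP; split => // t _; rewrite -preimage_bigcup -UF.
move=> i; have [mF Fi] := Foo i; split.
  by rewrite -[X in measurable X]setTI; exact: mg.
rewrite /cons_measure /pushforward -comp_preimage.
by rewrite (_ : g \o _ = idfun)//; apply/funext => z /=; rewrite consK.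
Qed.

HB.instance Definition _ := Measure_isSigmaFinite.Build _ _ _ cons_measure
  cons_measure_sigma_finite.

End Step.

(* The q-fold product of mu, on the product sigma-algebra of q.-tuple T. *)
Fixpoint tuple_measure (q : nat) :
    {sigma_finite_measure set (q.-tuple T) -> \bar R} :=
  match q with
  | 0%N => @dirac _ (0.-tuple T) [tuple] R
  | q'.+1 => cons_measure (tuple_measure q')
  end.

End TuplePower.

Definition tuple_set (T : Type) (A : set T) (q : nat) : set (q.-tuple T) :=
  [set t | forall i : 'I_q, A (tnth t i)].
Arguments tuple_set {T} A q.

(* The library declares the counting measure on nat sigma-finite, but not
   s-finite, which its sigma-finite measure structure also requires. *)
HB.instance Definition _ (R : realType) :=
  isSFinite.Build _ _ _ (@counting nat R)
    (sfinite_measure_sigma_finite (sigma_finite_counting R)).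

Section LimitMeasure.
Variable R : realType.

Definition base_measure : set (measurableTypeR R * nat)%type -> \bar R :=
  (@lebesgue_measure R \x @counting nat R)%E.

HB.instance Definition _ := Measure.on base_measure.

HB.instance Definition _ := Measure_isSigmaFinite.Build _ _ _ base_measure
  (product_sigma_finite (@lebesgue_measure R) (@counting nat R)).

(* E = (0, oo) * nat, as a subset of R * nat *)
Definition Espace : set (R * nat) := [set z | 0 < z.1].

Definition Fexp (x lambda : R) : R :=
  x ^+ 3 / 6 - lambda * x ^+ 2 / 2 + lambda ^+ 2 * x / 2.

Definition rho (w : nat -> R) (r : nat) (x : R) : R :=
  w r / Num.sqrt (2 * pi) * x `^ (3 * r%:R / 2 - 5 / 2).

Definition mdensity (w : nat -> R) (lambda : R) (q : nat)
    (t : q.-tuple (R * nat)) : R :=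
  expR (- Fexp (\sum_(i < q) (tnth t i).1) lambda)
  * \prod_(i < q) rho w (tnth t i).2 (tnth t i).1.

Definition alpha (w : nat -> R) (lambda : R) (q : nat)
    (A : set (q.-tuple (R * nat))) : \bar R :=
  (\int[tuple_measure base_measure q]_(t in A `&` tuple_set Espace q)
    (mdensity w lambda t)%:E)%E.

Definition Kset (a b : R) (R0 : nat) : set (R * nat) :=
  `[a, b] `*` [set r | (r <= R0)%N].

End LimitMeasure.

(* Main.v *)
Require Import Defs.
From mathcomp Require Import all_boot all_order all_algebra ring lra.
From mathcomp Require Import all_classical all_reals all_analysis.
Import Order.TTheory GRing.Theory Num.Theory.
Import numFieldNormedType.Exports.
Set Implicit Arguments.
Unset Strict Implicit.
Unset Printing Implicit Defensive.
Local Open Scope ring_scope.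

(** The bounds on the limit measure come from the factor [expR (- F)] of the
density. On the [q]-th power of the window the total size [x] is between
[q * a] and [q * b], the cubic polynomial [F] satisfies
[x ^+ 3 / 24 <= F x <= D * x ^+ 3] there ([Fexp_ge], [Fexp_le]), and the other
factors of the density and the mass of the window only contribute powers of
constants ([alpha_bounds]).

For the second part it is enough to have a lower bound
[delta ^+ q * expR (- (B * q ^+ 3))] for the factorial moments, with [delta] and
[B] independent of [q], for each [q] and all [n] large enough depending on [q]
([Xi_factorial_moment_ge]): an upper bound
[C ^+ q * expR (- (c * q `^ (3 + eps)))] uniform in [n] contradicts it as [q]
grows ([no_faster_decay]). Only components that are trees are counted, which is
legitimate since surplus 0 belongs to the window.

The lower bound is obtained by removing tree components one after the other
([moment_rec]). Once a set [S] of [k] vertices carrying a tree, with no edge to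
the other vertices, is removed from a graph on [v] vertices, what is left is a
random graph with the same edge probability on [v - k] vertices. Hence the
[q]-th factorial moment is at least the product of [q] lower bounds for the
expected number of tree components of sizes in the window, valid for all [v]
between [n] and [n - q * b * n `^ (2 / 3)] ([moment_lower_bound]). Such an
expectation is a sum of about [(b - a) * n `^ (2 / 3)] terms
['C(v, k) * c(k, k - 1) * p ^+ (k - 1) * (1 - p) ^+ M], and Stirling's formula,
the asymptotics of [c(k, k - 1)] and second order expansions of the logarithm
show that each is at least a constant times
[n `^ (- (2 / 3)) * expR (- (B * q ^+ 2))] ([tree_term_ge]): the divergent
exponents cancel exactly ([tree_exponent_ge]), and what the removal of at most
[q * b * n `^ (2 / 3)] vertices leaves is quadratic in [q]. Multiplying the [q]
steps gives the cube. *)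

(** * Inequalities for the exponential and the factorial *)

Section RealInequalities.
Context {R : realType}.
Implicit Types x u : R.

(** The inequality [1 - y <= expR (- y)] at [y = x / (1 + x)] gives
[expR y <= 1 + x], and [y] is at least the truncated logarithm [x - 2 * x ^+ 2]. *)
Lemma expR_le1Dx x : - 2^-1 <= x -> expR (x - 2 * x ^+ 2) <= 1 + x.
Proof.
move=> xge; have x1 : 0 < 1 + x by lra.
have : 1 + - (x / (1 + x)) <= expR (- (x / (1 + x))) by exact: expR_ge1Dx.
have -> : 1 + - (x / (1 + x)) = (1 + x)^-1 by field; lra.
rewrite expRN lef_pV2 ?posrE ?expR_gt0// => /(le_trans _); apply.
rewrite ler_expR -subr_ge0.
have -> : x / (1 + x) - (x - 2 * x ^+ 2) = x ^+ 2 * (1 + 2 * x) / (1 + x) by field; lra.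
apply: divr_ge0; last lra.
by apply: mulr_ge0; [exact: sqr_ge0|lra].
Qed.

Lemma expR_le1DxX x (k : nat) : - 2^-1 <= x ->
  expR (k%:R * (x - 2 * x ^+ 2)) <= (1 + x) ^+ k.
Proof. by move=> xge; rewrite expRM_natl lerXn2r ?nnegrE ?expR_ge0 ?expR_le1Dx//; lra. Qed.

(** The difference of the two sides vanishes at 0, and its derivative
[1 - expR (2 * u) * (1 - 2 * u)] is nonnegative. *)
Lemma expR_sub_le u : 0 <= u -> expR (2 * u) * (1 - u) <= 1 + u.
Proof.
rewrite le_eqVlt => /predU1P[<-|u0]; first by rewrite mulr0 expR0; lra.
pose h (v : R) := 1 + v - expR (2 * v) * (1 - v).
pose dh (v : R) := 1 - expR (2 * v) * (1 - 2 * v).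
have hd (v : R) : is_derive v 1 h (dh v).
  rewrite /h; apply: is_derive_eq; rewrite /dh /GRing.scale/=; ring.
have [|c _ hc] := @MVT_segment R h dh 0 u (ltW u0) (fun v _ => hd v).
  apply: continuous_subspaceT => v.
  by apply/differentiable_continuous/derivable1_diffP; have [] := hd v.
suff : 0 <= h u by rewrite /h subr_ge0.
have h0 : h 0 = 0 by rewrite /h mulr0 expR0; lra.
rewrite -[h u]subr0 -[X in _ - X]h0 hc subr0 mulr_ge0 ?(ltW u0)// subr_ge0.
have : 1 + (- (2 * c)) <= expR (- (2 * c)) by exact: expR_ge1Dx.
by rewrite expRN -[X in _ <= X]mul1r ler_pdivlMr ?expR_gt0// mulrC.
Qed.

(** This is [expR 1 <= (1 + k^-1) `^ (k + 1/2)], the previous lemma at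
[u = (2 * k + 1)^-1], where [(1 + u) / (1 - u)] is [1 + k^-1]. The extra
1/2 in the exponent is what yields the square root in Stirling's bound. *)
Lemma expR1_le (k : nat) : (0 < k)%N ->
  expR 1 * Num.sqrt k%:R * k%:R ^+ k <= Num.sqrt k.+1%:R * k.+1%:R ^+ k :> R.
Proof.
move=> k0; set x : R := k%:R.
have x0 : 0 < x by rewrite ltr0n.
have -> : k.+1%:R = x + 1 :> R by rewrite natr1.
pose u : R := (2 * x + 1)^-1.
have u0 : 0 < u by rewrite invr_gt0; lra.
have eu : expR (2 * u) <= (x + 1) / x.
  have := expR_sub_le (ltW u0).
  have -> : 1 - u = 2 * x * u by rewrite /u; field; lra.
  have -> : 1 + u = 2 * (x + 1) * u by rewrite /u; field; lra.
  rewrite mulrA ler_pM2r// => H; rewrite ler_pdivlMr//; lra.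
have euk : expR (2 * x * u) <= ((x + 1) / x) ^+ k.
  rewrite (_ : 2 * x * u = k%:R * (2 * u)); last by rewrite -/x; ring.
  by rewrite expRM_natl lerXn2r ?nnegrE ?expR_ge0// divr_ge0//; lra.
have eus : expR u <= Num.sqrt ((x + 1) / x).
  rewrite -[leLHS]ger0_norm ?expR_ge0// -sqrtr_sqr ler_sqrt; last by rewrite divr_ge0//; lra.
  by rewrite -expRM_natl.
have : expR 1 <= Num.sqrt ((x + 1) / x) * ((x + 1) / x) ^+ k.
  rewrite [X in expR X](_ : 1 = u + 2 * x * u); last by rewrite /u; field; lra.
  by rewrite expRD ler_pM// expR_ge0.
rewrite sqrtrM ?sqrtrV ?expr_div_n; try lra.
rewrite mulrACA -invfM ler_pdivlMr ?mulrA//.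
by rewrite mulr_gt0 ?sqrtr_gt0 ?exprn_gt0.
Qed.

(** The ratio of the right side to the left side is nondecreasing in [k] by
[expR1_le] and equals 1 at [k = 1]. The factor [Num.sqrt k] has the exact order: a
cruder power of [k] would let the lower bound on the expected number of tree
components in the window tend to 0. *)
Lemma fact_le_stirling (k : nat) : (0 < k)%N ->
  k`!%:R * expR k%:R <= expR 1 * Num.sqrt k%:R * k%:R ^+ k :> R.
Proof.
elim: k => // -[_ _|k IH _]; first by rewrite sqrtr1 expr1 !mulr1 mul1r.
rewrite factS natrM -[in expR _]natr1 expRD.
have := IH isT => {}IH.
have -> : k.+2%:R * k.+1`!%:R * (expR k.+1%:R * expR 1) =
  expR 1 * k.+2%:R * (k.+1`!%:R * expR k.+1%:R) :> R by ring.
apply: le_trans (ler_wpM2l _ IH) _; first by rewrite mulr_ge0 ?expR_ge0.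
apply: le_trans (ler_wpM2l _ (expR1_le (ltn0Sn k))) _; first by rewrite mulr_ge0 ?expR_ge0.
by rewrite [k.+2%:R ^+ k.+2]exprS le_eqVlt; apply/orP; left; apply/eqP; ring.
Qed.

End RealInequalities.

(** * Bounds on the limit measure *)

Section IntegralBounds.
Local Open Scope classical_set_scope.
Local Open Scope ereal_scope.
Context d (T : measurableType d) (R : realType) (mu : {measure set T -> \bar R}).

(** The integral of a nonnegative function is the supremum of the integrals of the
simple functions below it, hence monotone on arbitrary functions. *)
Lemma integral_le_cst (D : set T) (f : T -> R) (c : R) : measurable D ->
  (forall x, D x -> (0 <= f x <= c)%R) ->
  \int[mu]_(x in D) (f x)%:E <= c%:E * mu D.
Proof.
move=> mD fc; rewrite -integral_cst//.
rewrite !ge0_integralE; last 2 first.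
- by move=> x /fc /andP[f0 fc']; rewrite lee_fin (le_trans f0).
- by move=> x /fc /andP[f0 _]; rewrite lee_fin.
apply: ereal_sup_le => _ [g gf <-]; exists g => // x.
apply: le_trans (gf x) _; rewrite /patch; case: ifPn => // /set_mem /fc /andP[_].
by rewrite lee_fin.
Qed.

Lemma cst_le_integral (D : set T) (f : T -> R) (c : R) : measurable D -> (0 <= c)%R ->
  (forall x, D x -> (c <= f x)%R) ->
  c%:E * mu D <= \int[mu]_(x in D) (f x)%:E.
Proof.
move=> mD c0 fc; rewrite -integral_cst//.
rewrite !ge0_integralE; last 2 first.
- by move=> x /fc cf; rewrite lee_fin (le_trans c0).
- by move=> x _; rewrite lee_fin.
apply: ereal_sup_le => _ [g gf <-]; exists g => // x.
apply: le_trans (gf x) _; rewrite /patch; case: ifPn => // /set_mem /fc.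
by rewrite lee_fin.
Qed.

End IntegralBounds.

Section TuplePower.
Local Open Scope classical_set_scope.
Local Open Scope ereal_scope.
Context d (T : measurableType d) (R : realType).
Variable mu : {sigma_finite_measure set T -> \bar R}.

Lemma measurable_tuple_set (A : set T) q : measurable A -> measurable (tuple_set A q).
Proof.
move=> mA.
rewrite (_ : tuple_set A q =
    \bigcap_(i in [set: 'I_q]) ((fun t : q.-tuple T => tnth t i) @^-1` A)).
  apply: fin_bigcap_measurable => // i _.
  rewrite -[X in measurable X]setTI; exact: measurable_tnth.
by apply/seteqP; split => [t tA i _|t tA i]; exact: tA.
Qed.

Lemma tuple_measure_tuple_set (A : set T) q : measurable A ->
  tuple_measure mu q (tuple_set A q) = (mu A) ^+ q.
Proof.
move=> mA; elim: q => [|q IH].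
  by rewrite expe0 /= diracE mem_set// => -[].
rewrite expeS -IH /= /cons_measure /pushforward.
rewrite -product_measure1E//; last exact: measurable_tuple_set.
congr (_ _); apply/seteqP; split => [[x t] xt|[x t] [/= Ax At] i].
  split => [|i]; first exact: (xt ord0).
  by have := xt (lift ord0 i); rewrite /= tnthS.
rewrite /tuple_cons/=; case: (unliftP ord0 i) => [j ->|->].
  by rewrite tnthS; exact: At.
by rewrite tnth0.
Qed.

End TuplePower.

Section LimitMeasureBounds.
Local Open Scope classical_set_scope.
Context {R : realType}.

Lemma measurable_Kset (a b : R) (R0 : nat) :
  measurable (Kset a b R0 : set (measurableTypeR R * nat)).
Proof. exact: measurableX. Qed.

Lemma base_measure_Kset (a b : R) (R0 : nat) : a < b ->
  base_measure (Kset a b R0) = ((b - a) * R0.+1%:R)%:E.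
Proof.
move=> ab; rewrite /base_measure product_measure1E//.
rewrite EFinM; congr (_ * _)%E.
  by have := lebesgue_measure_itv `[a, b]%R; rewrite /= lte_fin ab.
have -> : [set r | (r <= R0)%N] = `I_R0.+1 by apply/seteqP; split.
rewrite /= /counting asboolT; last exact: finite_II.
by rewrite (card_fset_set (card_eqxx _)).
Qed.

(** The remainder after removing [x ^+ 3 / 24] is [x / 2] times the perfect
square of [x / 2 - lambda]: 24 is the least denominator that works for every
[lambda]. *)
Lemma Fexp_ge (x lambda : R) : 0 <= x -> x ^+ 3 / 24 <= Fexp x lambda.
Proof.
move=> x0; rewrite /Fexp -subr_ge0.
have -> : x ^+ 3 / 6 - lambda * x ^+ 2 / 2 + lambda ^+ 2 * x / 2 - x ^+ 3 / 24 =
  x * (x / 2 - lambda) ^+ 2 / 2 by field.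
by rewrite divr_ge0// mulr_ge0 ?sqr_ge0.
Qed.

(** Away from the origin the lower powers of [x] are absorbed in the cube, at the
price of one factor [x / a >= 1] for each missing power. *)
Lemma Fexp_le (a x lambda : R) : 0 < a -> a <= x ->
  Fexp x lambda <= (6^-1 + `|lambda| / (2 * a) + lambda ^+ 2 / (2 * a ^+ 2)) * x ^+ 3.
Proof.
move=> a0 ax; have x0 : 0 < x by exact: lt_le_trans ax.
have ax1 : 1 <= x / a by rewrite ler_pdivlMr ?mul1r.
have l2 : lambda ^+ 2 * x / 2 <= lambda ^+ 2 / (2 * a ^+ 2) * x ^+ 3.
  have -> : lambda ^+ 2 / (2 * a ^+ 2) * x ^+ 3 = lambda ^+ 2 * x / 2 * (x / a) ^+ 2.
    by field; rewrite gt_eqF.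
  apply: ler_peMr; last exact: exprn_ege1.
  by apply: divr_ge0 => //; apply: mulr_ge0; rewrite ?sqr_ge0 ?ltW.
have l1 : - (lambda * x ^+ 2 / 2) <= `|lambda| / (2 * a) * x ^+ 3.
  have -> : `|lambda| / (2 * a) * x ^+ 3 = `|lambda| * x ^+ 2 / 2 * (x / a).
    by field; rewrite gt_eqF.
  apply: (@le_trans _ _ (`|lambda| * x ^+ 2 / 2)).
    have : (- lambda) * x ^+ 2 <= `|lambda| * x ^+ 2.
      by rewrite ler_wpM2r ?sqr_ge0// -normrN ler_norm.
    lra.
  apply: ler_peMr => //; apply: divr_ge0 => //.
  by apply: mulr_ge0; rewrite ?sqr_ge0.
rewrite /Fexp; move: (`|lambda| / _) (_ / (2 * a ^+ 2)) l1 l2 => A B l1 l2; lra.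
Qed.

Lemma finite_bounds (w : nat -> R) (R0 : nat) : (forall r, 0 < w r) ->
  exists m M : R, [/\ 0 < m, 0 < M & forall r, (r <= R0)%N -> m <= w r <= M].
Proof.
move=> w0; elim: R0 => [|R0 [m [M [m0 M0 mM]]]].
  by exists (w 0%N), (w 0%N); split => // r; rewrite leqn0 => /eqP->; rewrite !lexx.
exists (Num.min m (w R0.+1)), (Num.max M (w R0.+1)); split.
- by rewrite lt_min m0 w0.
- by rewrite lt_max M0.
- move=> r; rewrite leq_eqVlt ltnS => /predU1P[->|/mM /andP[mr rM]].
    by rewrite ge_min le_max !lexx !orbT.
  by rewrite ge_min le_max mr rM.
Qed.

(** The exponent of [x] in [rho] changes sign with the surplus, so the power is
bounded through its logarithm, uniformly in both coordinates. *)
Lemma rho_bounds (w : nat -> R) (a b : R) (R0 : nat) : (forall r, 0 < w r) ->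
    0 < a ->
  exists m M : R, [/\ 0 < m, 0 < M & forall z, Kset a b R0 z -> m <= rho w z.2 z.1 <= M].
Proof.
move=> w0 a0; have [m [M [m0 M0 mM]]] := finite_bounds R0 w0.
pose c : R := (Num.sqrt (2 * pi))^-1.
have c0 : 0 < c by rewrite invr_gt0 sqrtr_gt0 mulr_gt0// pi_gt0.
pose L : R := (3 * R0%:R / 2 + 5 / 2) * (`|ln a| + `|ln b|).
exists (m * c * expR (- L)), (M * c * expR L); split.
- by rewrite !mulr_gt0 ?expR_gt0.
- by rewrite !mulr_gt0 ?expR_gt0.
move=> [x r] [/= + rR]; rewrite in_itv/= => /andP[ax xb].
have x0 : 0 < x by exact: lt_le_trans ax.
have b0 : 0 < b by exact: lt_le_trans xb.
have /andP[mr rM] := mM r rR.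
have /ler_normlP[eL1 eL2] : `|(3 * r%:R / 2 - 5 / 2) * ln x| <= L.
  rewrite normrM; apply: ler_pM => //.
    have rR' : r%:R <= R0%:R :> R by rewrite ler_nat.
    by rewrite ler_norml; apply/andP; split; have := ler0n R r; lra.
  have la : ln a <= ln x by rewrite ler_ln.
  have lb : ln x <= ln b by rewrite ler_ln.
  have := ler_norm (ln b); have := ler_norm (- ln a); rewrite normrN.
  have := normr_ge0 (ln a); have := normr_ge0 (ln b).
  by rewrite ler_norml => *; apply/andP; split; lra.
rewrite /rho -/c /powR gt_eqF//.
apply/andP; split; apply: ler_pM; rewrite ?ler_expR ?mulr_ge0 ?expR_ge0
  ?(ltW c0) ?(ltW m0) ?(ltW (w0 r)) ?ler_pM2r//.
lra.
Qed.

(** The total size of [q] points of the window lies between [q * a] and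
[q * b], so the exponential factor is squeezed between two exponentials in
[q ^+ 3]; the [q] factors [rho] only contribute an exponential in [q]. *)
Lemma mdensity_bounds (w : nat -> R) (lambda a b : R) (R0 : nat) :
    (forall r, 0 < w r) -> 0 < a -> a < b ->
  exists m M B B' : R, [/\ [/\ 0 < m, 0 < M, 0 < B & 0 < B'] &
    forall q (t : q.-tuple (R * nat)), (0 < q)%N -> tuple_set (Kset a b R0) q t ->
     m ^+ q * expR (- (B * q%:R ^+ 3)) <= mdensity w lambda t
       <= M ^+ q * expR (- (B' * q%:R ^+ 3))].
Proof.
move=> w0 a0 ab; have [m [M [m0 M0 mM]]] := rho_bounds b R0 w0 a0.
have b0 : 0 < b by exact: lt_trans ab.
pose D := 6^-1 + `|lambda| / (2 * a) + lambda ^+ 2 / (2 * a ^+ 2).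
have D0 : 0 < D.
  have l1 : 0 <= `|lambda| / (2 * a).
    by apply: divr_ge0 => //; apply: mulr_ge0 => //; exact: ltW.
  have l2 : 0 <= lambda ^+ 2 / (2 * a ^+ 2).
    by apply: divr_ge0; rewrite ?sqr_ge0//; apply: mulr_ge0; rewrite ?sqr_ge0.
  by rewrite /D -addrA ltr_pwDl// addr_ge0.
exists m, M, (D * b ^+ 3), (a ^+ 3 / 24); split.
  by split; rewrite ?mulr_gt0 ?exprn_gt0.
move=> q t q0 tK; rewrite /mdensity; set S := \sum_(i < q) _.
have Sa : q%:R * a <= S.
  rewrite -[q in q%:R]card_ord mulr_natl -sumr_const; apply: ler_sum => i _.
  by have [] := tK i; rewrite /= in_itv/= => /andP[].
have Sb : S <= q%:R * b.
  rewrite -[q in q%:R]card_ord mulr_natl -sumr_const; apply: ler_sum => i _.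
  by have [] := tK i; rewrite /= in_itv/= => /andP[].
have q1 : 1 <= q%:R :> R by rewrite ler1n.
have aS : a <= S by apply: le_trans Sa; rewrite ler_peMl ?(ltW a0).
have S0 : 0 <= S by lra.
have prodm : m ^+ q <= \prod_(i < q) rho w (tnth t i).2 (tnth t i).1.
  rewrite -[q in m ^+ q]card_ord -prodr_const; apply: ler_prod => i _.
  by have /andP[-> _] := mM _ (tK i); rewrite (ltW m0).
have prodM : \prod_(i < q) rho w (tnth t i).2 (tnth t i).1 <= M ^+ q.
  rewrite -[q in M ^+ q]card_ord -prodr_const; apply: ler_prod => i _.
  by have /andP[mr ->] := mM _ (tK i); rewrite andbT (le_trans _ mr) ?ltW.
rewrite [m ^+ q * _]mulrC [M ^+ q * _]mulrC; apply/andP; split.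
  apply: ler_pM; rewrite ?expR_ge0 ?exprn_ge0 ?(ltW m0)// ler_expR lerN2.
  apply: le_trans (Fexp_le lambda a0 aS) _; rewrite -/D -mulrA ler_pM2l//.
  by rewrite mulrC -exprMn lerXn2r ?nnegrE// (le_trans S0).
apply: ler_pM; rewrite ?expR_ge0 ?(le_trans _ prodm) ?exprn_ge0 ?(ltW m0)// ler_expR lerN2.
apply: le_trans (Fexp_ge lambda S0); rewrite mulrAC ler_wpM2r// -exprMn mulrC lerXn2r ?nnegrE//.
by rewrite mulr_ge0 ?(ltW a0).
Qed.

Lemma alpha_bounds (w : nat -> R) (lambda a b : R) (R0 : nat) :
    (forall r, 0 < w r) -> 0 < a -> a < b ->
  exists Am Ap Bm Bp : R,
    [/\ 0 < Am, 0 < Ap, 0 < Bm & 0 < Bp] /\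
    forall q : nat, (1 <= q)%N ->
      ((Am ^+ q * expR (- (Bm * q%:R ^+ 3)))%:E
         <= alpha w lambda (tuple_set (Kset a b R0) q))%E /\
      (alpha w lambda (tuple_set (Kset a b R0) q)
         <= (Ap ^+ q * expR (- (Bp * q%:R ^+ 3)))%:E)%E.
Proof.
move=> w0 a0 ab.
have [m [M [B [B' [[m0 M0 B0 B'0] mM]]]]] := mdensity_bounds lambda R0 w0 a0 ab.
pose v := (b - a) * R0.+1%:R.
have v0 : 0 < v by rewrite mulr_gt0 ?subr_gt0.
exists (m * v), (M * v), B, B'; split; first by split => //; exact: mulr_gt0.
move=> q q0; rewrite /alpha.
have -> : tuple_set (Kset a b R0) q `&` tuple_set (@Espace R) q = tuple_set (Kset a b R0) q.
  apply/setIidPl => t tK i; have [+ _] := tK i.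
  by rewrite /= in_itv/= => /andP[+ _]; exact: lt_le_trans.
have mK := measurable_tuple_set (q := q) (measurable_Kset a b R0).
have KE : tuple_measure (base_measure (R := R)) q (tuple_set (Kset a b R0) q) = (v ^+ q)%:E.
  rewrite tuple_measure_tuple_set; last exact: measurable_Kset.
  by rewrite EFin_expe; congr (_ ^+ _)%E; exact: base_measure_Kset.
split.
  rewrite exprMn mulrAC EFinM -KE; apply: cst_le_integral => //.
    by rewrite mulr_ge0 ?expR_ge0 ?exprn_ge0 ?(ltW m0).
  by move=> t /(mM q t q0)/andP[].
rewrite exprMn mulrAC EFinM -KE; apply: integral_le_cst => // t /(mM q t q0)/andP[lo ->].
by rewrite andbT (le_trans _ lo)// mulr_ge0 ?expR_ge0 ?exprn_ge0 ?(ltW m0).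
Qed.

End LimitMeasureBounds.

(** * Removing a tree component *)

Section InducedGraphs.
Context {n : nat}.
Implicit Types (S V C e : {set 'I_n}) (t H : {set {set 'I_n}}) (W : pred nat).

(** Graphs are handled as bare edge sets over the fixed vertex type ['I_n], a graph
on [V] being a subset of [pairs_in V]: deleting the vertices of a component then
requires no relabelling. *)
Definition pairs_in V : {set {set 'I_n}} := [set e in pairs n | e \subset V]%SET.

Definition edge_rel H : rel 'I_n := fun x y => [set x; y]%SET \in H.

(** Spanning trees of [S], as connected graphs with one edge less than vertices;
the equation on cardinals also excludes the empty [S]. *)
Definition trees S : {set {set {set 'I_n}}} :=
  [set t in powerset (pairs_in S) | (#|t|.+1 == #|S|) &&
     [forall x in S, forall y in S, connect (edge_rel t) x y]]%SET.

Definition tree_component H S : bool :=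
  ((H :&: pairs_in S)%SET \in trees S) &&
  [forall e in H, (e \subset S) || [disjoint e & S]].

Definition tree_components W V H : {set {set 'I_n}} :=
  [set S : {set 'I_n} | [&& S \subset V, W #|S| & tree_component H S]]%SET.

Lemma card_pairs_in V : #|pairs_in V| = 'C(#|V|, 2).
Proof.
by rewrite -cards_draws; apply: eq_card => e; rewrite !inE andbC.
Qed.

Lemma pairs_inS S V : S \subset V -> pairs_in S \subset pairs_in V.
Proof.
move=> SV; apply/fintype.subsetP => e; rewrite !inE => /andP[-> /=] eS.
exact: fintype.subset_trans SV.
Qed.

Lemma pairs_in_neq0 V e : e \in pairs_in V -> e != finset.set0.
Proof. by rewrite !inE => /andP[/eqP e2 _]; rewrite -card_gt0 e2. Qed.

Lemma pair_not_in_disjoint {V S e} : e \in pairs_in V -> [disjoint V & S] ->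
  ~~ (e \subset S).
Proof.
move=> eV dVS; apply/negP => eS; move/negP: (pairs_in_neq0 eV); apply.
rewrite -finset.subset0 -(disjoint_setI0 dVS) finset.subsetI eS andbT.
by move: eV; rewrite !inE => /andP[].
Qed.

Lemma tree_neq0 S t : t \in trees S -> S != finset.set0.
Proof. by rewrite !inE => /andP[_ /andP[/eqP tS _]]; rewrite -card_gt0 -tS. Qed.

Lemma tree_sub S t : t \in trees S -> t \subset pairs_in S.
Proof. by rewrite inE powersetE => /andP[]. Qed.

Lemma tree_card S t : t \in trees S -> #|t| = #|S|.-1.
Proof. by rewrite inE => /andP[_ /andP[/eqP<-]]. Qed.

(** A tree [t] on [S] is put together with a graph [H] on the other vertices of
[V]. *)
Section Split.
Variables (V S : {set 'I_n}) (t H : {set {set 'I_n}}).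
Hypotheses (SV : S \subset V) (tS : t \in trees S).
Hypothesis HVS : H \subset pairs_in (V :\: S).

Let dS : [disjoint S & V :\: S].
Proof. by rewrite finset.disjoints_subset; apply/fintype.subsetP => x xS; rewrite !inE xS. Qed.

Let memS e : e \in pairs_in S -> (e \in t :|: H)%SET = (e \in t).
Proof.
move=> eS; rewrite inE; case: (e \in t) => //=.
apply/negbTE/negP => eH; have /fintype.subsetP/(_ _ eH) := HVS.
rewrite inE => /andP[_]; exact/negP/(pair_not_in_disjoint eS dS).
Qed.

Let memVS e : e \in pairs_in (V :\: S) -> (e \in t :|: H)%SET = (e \in H).
Proof.
move=> eS; rewrite inE orbC; case: (e \in H) => //=.
apply/negbTE/negP => et; have /fintype.subsetP/(_ _ et) := tree_sub tS.
rewrite inE => /andP[_]; apply/negP/(pair_not_in_disjoint eS).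
by rewrite disjoint_sym.
Qed.

Lemma join_tree_capS : ((t :|: H) :&: pairs_in S)%SET = t.
Proof.
apply/setP => e; rewrite inE andbC; have [eS|eS] /= := boolP (e \in pairs_in S).
  by rewrite memS.
by apply/esym/negbTE; apply: contra eS; apply/fintype.subsetP/tree_sub.
Qed.

Lemma join_tree_capVS : ((t :|: H) :&: pairs_in (V :\: S))%SET = H.
Proof.
apply/setP => e; rewrite inE andbC.
have [eS|eS] /= := boolP (e \in pairs_in (V :\: S)); first by rewrite memVS.
by apply/esym/negbTE; apply: contra eS; apply/fintype.subsetP.
Qed.

Lemma join_tree_sub : (t :|: H)%SET \subset pairs_in V.
Proof.
rewrite finset.subUset (fintype.subset_trans (tree_sub tS))/= ?pairs_inS//.
by rewrite (fintype.subset_trans HVS)// pairs_inS// finset.subDset finset.subsetUr.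
Qed.

Lemma join_tree_component : tree_component (t :|: H)%SET S.
Proof.
rewrite /tree_component join_tree_capS tS/=.
apply/forall_inP => e; rewrite inE => /orP[/(fintype.subsetP (tree_sub tS))|].
  by rewrite inE => /andP[_ ->].
move=> /(fintype.subsetP HVS); rewrite inE => /andP[_ eV]; apply/orP; right.
apply: (disjointWl eV); by rewrite disjoint_sym.
Qed.

Lemma join_tree_componentE C : C \subset V :\: S -> tree_component H C ->
  tree_component (t :|: H)%SET C.
Proof.
move=> CV /andP[HC /forall_inP HCe].
have dSC : [disjoint S & C] by exact: disjointWr dS.
apply/andP; split.
  rewrite finset.setIUl (_ : t :&: _ = finset.set0)%SET ?finset.set0U//.
  apply/setP => e; rewrite !inE; apply/negbTE/negP => /andP[et /andP[_ eC]].
  have /fintype.subsetP/(_ _ et) eS := tree_sub tS.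
  by move/negP: (pair_not_in_disjoint eS dSC).
apply/forall_inP => e; rewrite inE => /orP[|/HCe//].
move=> /(fintype.subsetP (tree_sub tS)); rewrite inE => /andP[_ eS].
by apply/orP; right; exact: disjointWl dSC.
Qed.

(** Adding the tree [t] keeps every tree component of [H] and creates the new one
[S]: the strict inequality is what lowers the order of the falling factorial by
one. *)
Lemma join_tree_components W : W #|S| ->
  (#|tree_components W (V :\: S) H| < #|tree_components W V (t :|: H)%SET|)%N.
Proof.
move=> WS; apply: proper_card; apply/properP; split.
  apply/fintype.subsetP => C; rewrite !inE => /and3P[CV WC HC].
  rewrite WC join_tree_componentE// !andbT.
  by rewrite (fintype.subset_trans CV)// finset.subDset finset.subsetUr.
exists S; first by rewrite inE SV WS join_tree_component.
rewrite inE negb_and; apply/orP; left; apply: contra (tree_neq0 tS) => SVS.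
by rewrite -finset.subset0 -(disjoint_setI0 dS) finset.subsetI fintype.subxx.
Qed.

End Split.

End InducedGraphs.

Section Moments.
Context {R : realType} (p : R).
Hypothesis p01 : 0 <= p <= 1.
Context {n : nat}.
Implicit Types (S V C e : {set 'I_n}) (t H A : {set {set 'I_n}}) (W : pred nat).

Definition weight A H : R := \prod_(e in A) (if e \in H then p else 1 - p).

(** The [q]-th factorial moment, in the random graph on [V], of the number of
tree components whose number of vertices satisfies [W]. *)
Definition moment W V q : R :=
  \sum_(H in powerset (pairs_in V))
    weight (pairs_in V) H * (#|tree_components W V H| ^_ q)%:R.

Lemma weight_ge0 A H : 0 <= weight A H.
Proof.
have /andP[p0 p1] := p01.
by apply: prodr_ge0 => e _; case: ifP => // _; rewrite subr_ge0.
Qed.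

Lemma eq_weight A H (H' : {set {set 'I_n}}) : {in A, H =i H'} -> weight A H = weight A H'.
Proof. by move=> HH'; apply: eq_bigr => e /HH' ->. Qed.

Lemma weight_disjointU A (B : {set {set 'I_n}}) H : [disjoint A & B] ->
  weight (A :|: B) H = weight A H * weight B H.
Proof.
by move=> dAB; rewrite /weight -bigU//; apply: eq_bigl => e; rewrite !inE.
Qed.

Lemma weight_sub A H : H \subset A ->
  weight A H = p ^+ #|H| * (1 - p) ^+ (#|A| - #|H|).
Proof.
move=> HA; rewrite /weight (big_setID H)/= (finset.setIidPr HA).
rewrite (eq_bigr (fun=> p)); last by move=> e ->.
rewrite prodr_const; congr (_ * _).
rewrite (eq_bigr (fun=> 1 - p)); last by move=> e; rewrite inE => /andP[/negbTE->].
by rewrite prodr_const cardsD (finset.setIidPr HA).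
Qed.

(** The weights are the terms in the expansion of the product of the sums
[p + (1 - p)], one for each pair in [A]. *)
Lemma sum_weight A : \sum_(H in powerset A) weight A H = 1.
Proof.
(* Outside A only the choice of a non-edge survives, which restricts the
   expansion to the subsets of A. *)
pose F e := if e \in A then p else 0; pose G e := if e \in A then 1 - p else 1.
have : \prod_e (F e + G e) = 1.
  by rewrite big1// => e _; rewrite /F /G; case: ifP; rewrite ?subrKC ?add0r.
rewrite bigA_distr => <-; rewrite [RHS](bigID (fun H => H \subset A))/=.
rewrite [X in _ = _ + X]big1 ?addr0.
  apply: eq_big => [H|H]; first by rewrite powersetE.
  rewrite powersetE => HA; rewrite [RHS](bigID (mem A))/= mulrC big1 ?mul1r.
    by apply: eq_bigr => e eA; rewrite /F /G eA.
  move=> e eA; rewrite /F /G (negbTE eA); case: ifP => // /(fintype.subsetP HA).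
  by rewrite (negbTE eA).
move=> H /subsetPn[e eH eA]; rewrite (bigD1 e)//= eH.
by rewrite /F (negbTE eA) mul0r.
Qed.

Lemma moment0 W V : moment W V 0 = 1.
Proof.
rewrite -(sum_weight (pairs_in V)); apply: eq_bigr => H _.
by rewrite ffactn0 mulr1.
Qed.

Lemma leq_ffact m1 m2 q : (m1 <= m2)%N -> (m1 ^_ q <= m2 ^_ q)%N.
Proof.
elim: q m1 m2 => [|q IH] [|m1] [|m2] //= m12.
by rewrite !ffactnS leq_mul// IH.
Qed.

(** Among the pairs of [V] touching [S], exactly the edges of the tree are
present, and the independent choices inside [V :\: S] are unconstrained. The
exponent of [1 - p] counts the pairs touching [S] as those of [V] minus those of
[V :\: S]. *)
Lemma weight_join V S t H : S \subset V -> t \in trees S ->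
    H \subset pairs_in (V :\: S) ->
  weight (pairs_in V) (t :|: H) =
  p ^+ #|S|.-1 * (1 - p) ^+ ('C(#|V|, 2) - 'C(#|V| - #|S|, 2) - #|S|.-1) *
  weight (pairs_in (V :\: S)) H.
Proof.
move=> SV tS HVS.
have PVS : pairs_in (V :\: S) \subset pairs_in V.
  by rewrite pairs_inS// finset.subDset finset.subsetUr.
have -> : pairs_in V = ((pairs_in V :\: pairs_in (V :\: S)) :|: pairs_in (V :\: S))%SET.
  by rewrite finset.setUC -{1}(finset.setIidPr PVS) finset.setID.
rewrite weight_disjointU; last first.
  by rewrite disjoint_sym finset.disjoints_subset finset.setCD finset.subsetUr.
congr (_ * _); last first.
  apply: eq_weight => e eVS.
  have /setP/(_ e) := join_tree_capVS tS HVS.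
  by rewrite inE eVS andbT.
have tD : t \subset pairs_in V :\: pairs_in (V :\: S).
  rewrite finset.subsetD (fintype.subset_trans (tree_sub tS) (pairs_inS SV))/=.
  rewrite disjoint_subset; apply/fintype.subsetP => e et; apply/negP.
  have /fintype.subsetP/(_ _ et) eS := tree_sub tS.
  have dS : [disjoint S & V :\: S].
    rewrite disjoint_sym finset.disjoints_subset.
    by apply/fintype.subsetP => x; rewrite !inE => /andP[].
  by move=> eVS; have /negP[] := pair_not_in_disjoint eS dS; move: eVS; rewrite !inE => /andP[].
rewrite (@eq_weight _ _ t); last first.
  move=> e; rewrite inE => /andP[eVS _]; rewrite inE orbC.
  by case: (boolP (e \in H)) => // /(fintype.subsetP HVS); rewrite (negbTE eVS).
rewrite weight_sub// (tree_card tS) cardsD (finset.setIidPr PVS) !card_pairs_in.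
by rewrite cardsD (finset.setIidPr SV).
Qed.

Lemma ffact_tree_components W V H q :
  (#|tree_components W V H| ^_ q.+1)%:R =
  \sum_(S in tree_components W V H) (#|tree_components W V H|.-1 ^_ q)%:R :> R.
Proof. by rewrite sumr_const ffactnS natrM mulr_natl. Qed.

(** Peeling off one component: [x ^_ q.+1] is the sum, over the [x] tree
components [S], of [x.-1 ^_ q]; after exchanging the sums, the graphs having [S]
as a tree component include all those made of a tree on [S] and a graph on
[V :\: S], and for these [x.-1] is at least the count in [V :\: S]. *)
Lemma moment_rec W V q :
  \sum_(S : {set 'I_n} | (S \subset V) && W #|S|)
    #|trees S|%:R * (p ^+ #|S|.-1 *
      (1 - p) ^+ ('C(#|V|, 2) - 'C(#|V| - #|S|, 2) - #|S|.-1)) *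
      moment W (V :\: S) q
  <= moment W V q.+1.
Proof.
rewrite /moment.
under [leRHS]eq_bigr => H _ do
  rewrite ffact_tree_components mulr_sumr.
rewrite (exchange_big_dep (fun S => (S \subset V) && W #|S|))/=; last first.
  by move=> H S _; rewrite inE => /and3P[-> ->].
apply: ler_sum => S /andP[SV WS].
pose J := finset.setX (trees S) (powerset (pairs_in (V :\: S))).
pose g (x : {set {set 'I_n}} * {set {set 'I_n}}) := (x.1 :|: x.2)%SET.
have gJ x : x \in J -> (x.1 \in trees S) /\ (x.2 \subset pairs_in (V :\: S)).
  by case: x => t H; rewrite !inE/= => /andP[].
have ginj : {in J &, injective g}.
  move=> [t H] [t' H'] /gJ[/= tS HV] /gJ[/= tS' HV'].
  rewrite /g/= => tH.
  congr pair.
    by rewrite -(join_tree_capS tS HV) tH (join_tree_capS tS' HV').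
  by rewrite -(join_tree_capVS tS HV) tH (join_tree_capVS tS' HV').
pose f H := weight (pairs_in V) H * (#|tree_components W V H|.-1 ^_ q)%:R.
apply: (@le_trans _ _ (\sum_(H in g @: J) f H)); last first.
  rewrite [leRHS](bigID (mem (g @: J)))/= -[leLHS]addr0 lerD//; last first.
    by apply: sumr_ge0 => H _; rewrite mulr_ge0 ?weight_ge0.
  rewrite le_eqVlt; apply/orP; left; apply/eqP/eq_bigl => H.
  apply/idP/idP => [HJ|/andP[]//]; rewrite HJ andbT.
  have /imsetP[[t H'] /gJ[/= tS HV] ->] := HJ.
  by rewrite powersetE !inE (join_tree_sub SV tS HV) SV WS (join_tree_component tS HV).
rewrite big_imset//= -mulrA mulr_natl -sumr_const.
rewrite (eq_bigl (fun x => (x.1 \in trees S) && (x.2 \in powerset (pairs_in (V :\: S)))));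
  last by case=> t H; rewrite inE.
rewrite -(pair_big_dep (mem (trees S)) (fun _ H => H \in powerset (pairs_in (V :\: S)))
  (fun t H => f (g (t, H))))/=.
apply: ler_sum => t tS; rewrite mulr_sumr.
apply: ler_sum => H; rewrite powersetE => HV.
rewrite /f /g/= (weight_join SV tS HV) -!mulrA; apply: ler_wpM2l.
  by rewrite exprn_ge0//; case/andP: p01.
apply: ler_wpM2l; first by rewrite exprn_ge0// subr_ge0; case/andP: p01.
apply: ler_wpM2l; first exact: weight_ge0.
by rewrite ler_nat leq_ffact// -ltnS (leq_trans (join_tree_components SV tS HV WS))// leqSpred.
Qed.

End Moments.

Lemma connected_graphP k (G : sgraph k) (i j : 'I_k) :
  connected_graph G -> connect (adj G) i j.
Proof.
move=> /cards1P[C GC].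
have blockC x : [set y in [set: 'I_k] | connect (adj G) x y]%SET = C.
  by apply/set1P; rewrite -GC; apply/imsetP; exists x.
have : j \in C by rewrite -(blockC j) !inE connect0.
by rewrite -(blockC i) !inE.
Qed.

Lemma connected_graph_gt0 k (G : sgraph k) : connected_graph G -> (0 < k)%N.
Proof.
move=> /cards1P[C GC]; have : C \in components G by rewrite GC inE.
by case/imsetP => x _ _; exact: leq_ltn_trans (ltn_ord x).
Qed.

(** The vertices of [S] are relabelled through [enum_val], which carries the
connected graphs with [#|S|.-1] edges injectively to spanning trees of [S]. *)
Lemma nb_connected_le_trees n (S : {set 'I_n}) :
  (nb_connected #|S| #|S|.-1 <= #|trees S|)%N.
Proof.
pose f (i : 'I_#|S|) : 'I_n := enum_val i.
have finj : injective f by exact: enum_val_inj.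
pose h (G : sgraph #|S|) : {set {set 'I_n}} :=
  [set f @: (e : {set 'I_#|S|}) | e in edges G]%SET.
have hinj : injective h.
  by move=> G G' /(imset_inj (imset_inj finj))/val_inj.
rewrite /nb_connected -(card_imset _ hinj).
apply/subset_leq_card/fintype.subsetP => _ /imsetP[G + ->].
rewrite inE => /andP[Gconn /eqP Gcard].
rewrite inE powersetE (card_imset _ (imset_inj finj)) Gcard.
rewrite prednK ?(connected_graph_gt0 Gconn)// eqxx/=; apply/andP; split.
  apply/fintype.subsetP => _ /imsetP[e eG ->].
  have /fintype.subsetP/(_ _ eG) := valP G; rewrite !inE => e2.
  rewrite card_imset// e2/=; apply/fintype.subsetP => _ /imsetP[i _ ->].
  exact: enum_valP.
apply/forall_inP => x xS; apply/forall_inP => y yS.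
rewrite -(enum_rankK_in xS xS) -(enum_rankK_in xS yS) -/(f _) -/(f _).
have /connectP[s sp ->] := connected_graphP (enum_rank_in xS x) (enum_rank_in xS y) Gconn.
apply/connectP; exists (map f s); rewrite ?last_map//.
apply: homo_path sp => i j ij; apply/imsetP; exists [set i; j]%SET => //.
by rewrite imsetU !imset_set1.
Qed.

Lemma sum_subset_card (R : realType) n (V : {set 'I_n}) (W : pred nat) (g : nat -> R) :
  \sum_(S : {set 'I_n} | (S \subset V) && W #|S|) g #|S| =
  \sum_(k < #|V|.+1 | W k) 'C(#|V|, k)%:R * g k.
Proof.
rewrite (partition_big (fun S : {set 'I_n} => inord #|S| : 'I_#|V|.+1)
  (fun k : 'I_#|V|.+1 => W k))/=; last first.
  by move=> S /andP[SV WS]; rewrite inordK// ltnS subset_leq_card.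
apply: eq_bigr => k Wk; rewrite -cards_draws mulr_natl -sumr_const.
have SE (S : {set 'I_n}) : (S \subset V) && W #|S| && (inord #|S| == k) =
    (S \subset V) && (#|S| == k).
  have [SV|//] /= := boolP (S \subset V).
  rewrite -val_eqE /= inordK ?ltnS ?subset_leq_card//.
  by case: eqP => [->|]; rewrite ?andbF// Wk.
apply: eq_big => S; first by rewrite SE inE.
by rewrite SE => /andP[_ /eqP ->].
Qed.

Section MomentLowerBound.
Context {R : realType} (p : R).
Hypothesis p01 : 0 <= p <= 1.

(** Lower bound for the expected number of tree components on [k] vertices in the
random graph on [v] vertices. *)
Definition tree_term (v k : nat) : R :=
  'C(v, k)%:R * ((nb_connected k k.-1)%:R *
    (p ^+ k.-1 * (1 - p) ^+ ('C(v, 2) - 'C(v - k, 2) - k.-1))).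

(** Components are peeled off one at a time. Each of the [q] steps removes at most
[kmax] vertices, so the graph stays on at least [v0] vertices and every step
gains a factor [L]. *)
Lemma moment_lower_bound n (W : pred nat) (kmax v0 : nat) (L : R) :
    0 <= L -> (forall k, W k -> (k <= kmax)%N) ->
    (forall v, (v0 <= v <= n)%N -> L <= \sum_(k < v.+1 | W k) tree_term v k) ->
  forall q (V : {set 'I_n}), (v0 + q * kmax <= #|V|)%N -> L ^+ q <= moment p W V q.
Proof.
move=> L0 Wmax HL; elim=> [|q IH] V vV; first by rewrite expr0 moment0.
have [p0 p1] := andP p01; have p1' : 0 <= 1 - p by rewrite subr_ge0.
apply: le_trans (moment_rec p01 W V q).
have := HL #|V|; rewrite (leq_trans _ vV) ?leq_addr//=.
rewrite {1}[X in (_ <= X)%N](_ : n = #|'I_n|) ?max_card ?card_ord//.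
move=> /(_ isT) HLV; rewrite exprS.
apply: le_trans (ler_wpM2r (exprn_ge0 _ L0) HLV) _.
rewrite /tree_term -(sum_subset_card V W (fun k => (nb_connected k k.-1)%:R *
    (p ^+ k.-1 * (1 - p) ^+ ('C(#|V|, 2) - 'C(#|V| - k, 2) - k.-1)))) mulr_suml.
apply: ler_sum => S /andP[SV WS]; apply: ler_pM.
- by rewrite !mulr_ge0 ?exprn_ge0.
- by rewrite exprn_ge0.
- by rewrite ler_wpM2r ?mulr_ge0 ?exprn_ge0// ler_nat nb_connected_le_trees.
- apply: IH; rewrite cardsD (finset.setIidPr SV) leq_subRL; last exact: subset_leq_card.
  apply: leq_trans vV; by rewrite addnCA leq_add2l mulSn leq_add2r Wmax.
Qed.

End MomentLowerBound.

Lemma tree_component_in_components n (G : sgraph n) (S : {set 'I_n}) :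
  tree_component (edges G) S -> S \in components G /\ surplus G S = 0%N.
Proof.
move=> /andP[tS /forall_inP HS]; split; last first.
  move: (tS); rewrite inE => /andP[_ /andP[/eqP SE _]]; rewrite /surplus /nb_edges.
  suff -> : [set e in edges G | e \subset S]%SET = (edges G :&: pairs_in S)%SET.
    by rewrite SE subnn.
  apply/setP => e; rewrite !inE; have [eG|//] /= := boolP (e \in edges G).
  by have /fintype.subsetP/(_ _ eG) := valP G; rewrite inE => ->.
have /finset.set0Pn[x xS] := tree_neq0 tS.
apply/imsetP; exists x => //; apply/setP => y; rewrite !inE.
apply/idP/idP => [yS|/connectP[s sp ->]].
  move: tS; rewrite inE => /andP[_ /andP[_ /forall_inP/(_ x xS)/forall_inP/(_ y yS)]].
  by apply: connect_sub => u v uv; apply: connect1; move: uv; rewrite /edge_rel inE => /andP[].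
elim: s x xS sp => [|z s IH] x xS //= /andP[xz]; apply: IH.
have /orP[|] := HS _ xz; first by move=> /fintype.subsetP; apply; rewrite !inE eqxx orbT.
by rewrite -setI_eq0 => /eqP/setP/(_ x); rewrite !inE eqxx xS.
Qed.

(** A tree has surplus 0, so the point that it contributes is in [K] exactly when
its size passes the test. *)
Lemma moment_le_Xi_factorial_moment (R : realType) (lambda : R) n q (K : set (R * nat)) :
    0 <= pcrit lambda n <= 1 ->
  moment (pcrit lambda n) (fun k => ((n%:R `^ (- (2 / 3)) * k%:R)%R, 0%N) \in K)
    [set: 'I_n]%SET q <= Xi_factorial_moment lambda n q K.
Proof.
move=> p01; rewrite /Xi_factorial_moment /gnp_expectation.
set W := fun k => _; set p := pcrit _ _.
have pT : pairs_in [set: 'I_n]%SET = pairs n.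
  by apply/setP => e; rewrite inE finset.subsetT andbT.
rewrite /moment pT (eq_bigl (fun H : {set {set 'I_n}} => H \subset pairs n)); last first.
  by move=> H; rewrite powersetE.
rewrite (big_sub (fun H : {set {set 'I_n}} => H \subset pairs n)) /=.
apply: ler_sum => G _; apply: ler_pM => //; first exact: weight_ge0.
rewrite ler_nat leq_ffact//.
rewrite /Xi.
rewrite -sum1_card big_mkcond [leqRHS]big_mkcond.
apply: leq_sum => S _; case: ifPn => // /[!inE].
move=> /and3P[_ WS /tree_component_in_components[SG S0]].
by rewrite SG S0; move: WS; rewrite /W => ->.
Qed.

(** * Tree components in the critical window *)

Section TreeTerm.
Context {R : realType}.

(** Multiply the lower bounds on [1 - y] given by [expR_le1Dx] over the [k] factors
[v - i] of the falling factorial, where [y = (n - v + i) / n] is at most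
[U]. *)
Lemma ffact_ge_expR (n v k : nat) (U : R) : (0 < n)%N -> (v <= n)%N ->
    U <= 2^-1 -> (n%:R - v%:R + k%:R) / n%:R <= U ->
  n%:R ^+ k * expR (- (k%:R * (n%:R - v%:R) / n%:R + k%:R ^+ 2 / (2 * n%:R)
    + k%:R * (2 * U ^+ 2))) <= (v ^_ k)%:R.
Proof.
move=> n0 vn U2; have N0 : 0 < n%:R :> R by rewrite ltr0n.
have vN : v%:R <= n%:R :> R by rewrite ler_nat.
elim: k => [|k IH] kU.
  by rewrite expr0 !mul0r expr0n/= mul0r !addr0 oppr0 expR0 mulr1.
pose y : R := (n%:R - v%:R + k%:R) / n%:R.
have y0 : 0 <= y.
  by apply: divr_ge0 => //; apply: addr_ge0 => //; rewrite subr_ge0.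
have yU : y + n%:R^-1 <= U.
  by apply: le_trans kU; rewrite /y -[k.+1%:R]natr1 -[X in _ + X]mul1r -mulrDl addrA.
have N0' : 0 < n%:R^-1 :> R by rewrite invr_gt0.
have kv : (k <= v)%N.
  have : y <= 2^-1 by lra.
  rewrite /y ler_pdivrMr// => H; rewrite -(ler_nat R); lra.
rewrite ffactnSr natrM natrB// exprSr.
have -> : v%:R - k%:R = n%:R * (1 - y) :> R by rewrite /y; field; lra.
have -> : - (k.+1%:R * (n%:R - v%:R) / n%:R + k.+1%:R ^+ 2 / (2 * n%:R)
    + k.+1%:R * (2 * U ^+ 2)) = - (k%:R * (n%:R - v%:R) / n%:R + k%:R ^+ 2 / (2 * n%:R)
    + k%:R * (2 * U ^+ 2)) + (- y - n%:R^-1 / 2 - 2 * U ^+ 2) :> R.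
  by rewrite -natr1 /y; field; lra.
rewrite expRD mulrACA; apply: ler_pM.
- by rewrite mulr_ge0 ?expR_ge0 ?exprn_ge0// ltW.
- by rewrite mulr_ge0 ?expR_ge0// ltW.
- by apply: IH; rewrite -/y; lra.
- rewrite ler_pM2l//; apply: le_trans (expR_le1Dx _); last lra.
  rewrite ler_expR; have : y ^+ 2 <= U ^+ 2 by rewrite lerXn2r ?nnegrE; lra.
  by rewrite sqrrN; lra.
Qed.

Lemma bin2_sub_le (v k : nat) : (k <= v)%N ->
  ('C(v, 2) - 'C(v - k, 2) - k.-1)%:R <= k%:R * v%:R - k%:R ^+ 2 / 2 :> R.
Proof.
move=> kv; have bin2R m : 'C(m, 2)%:R = m%:R * (m%:R - 1) / 2 :> R.
  case: m => [|m]; first by rewrite !mul0r.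
  have : ('C(m.+1, 2) * 2)%:R = (m.+1 ^_ 2)%:R :> R by rewrite -bin_ffact.
  rewrite ffactnS ffactn1 !natrM/= => H.
  by have mE : m.+1%:R = m%:R + 1 :> R; [rewrite natr1|rewrite mE in H *; lra].
apply: (@le_trans _ _ ('C(v, 2) - 'C(v - k, 2))%:R); first by rewrite ler_nat leq_subr.
rewrite natrB ?leq_bin2l ?leq_subr// !bin2R natrB//.
have k0 : 0 <= k%:R :> R by [].
nra.
Qed.

(** In the critical window all diverging contributions cancel. Here [s] is the
cube root of [n], [K] the number of vertices of the component, [J] the number
of vertices already removed, and the four groups of terms are the exponents of
the falling factorial, of [K ^+ K / K`!], of the factor [1 + lambda / s] of [p] at the
power [K.-1], and of the power of [1 - p]. With [y = K * (J + K / 2) / s ^+ 3],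
the leading part of the last one is [- (1 + x) * (K - y)] with
[x = lambda / s], which compensates [- y], [K] and [K * x]. What remains is
bounded since [K <= b * s ^+ 2] and [J + K <= Q * s ^+ 2]; the bound is
quadratic in [Q]. *)
Lemma tree_exponent_ge (s lambda b Q K J p : R) :
    p = s ^- 3 * (1 + lambda / s) ->
    1 <= s -> - 1 <= lambda / s <= 1 -> 0 < b -> 0 <= J -> 0 < K ->
    K <= b * s ^+ 2 -> J + K <= Q * s ^+ 2 ->
    0 <= K * (s ^+ 3 - J) - K ^+ 2 / 2 ->
  - (2 * b * Q ^+ 2 + 2 * b * lambda ^+ 2 + 2^-1 + 8 * b + `|lambda| * b * Q)
   <= - (K * J / s ^+ 3 + K ^+ 2 / (2 * s ^+ 3) + K * (2 * (Q / s) ^+ 2)) + K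
      + (K * (lambda / s - 2 * (lambda / s) ^+ 2) - 2^-1)
      + (- p - 2 * p ^+ 2) * (K * (s ^+ 3 - J) - K ^+ 2 / 2).
Proof.
move=> + s1; have s0 : 0 < s by lra.
have S2 : 0 < s ^+ 2 by rewrite exprn_gt0.
have S3 : 0 < s ^+ 3 by rewrite exprn_gt0.
have [x xE] : exists x, x = lambda / s by exists (lambda / s).
have [U Udef] : exists U, U = Q / s by exists (Q / s).
rewrite -xE -Udef => pE /andP[x1 x2] b0 J0 K0 kb vkQ.
set M := K * (s ^+ 3 - J) - _ => M0.
have s3V : 0 < s ^- 3 by rewrite invr_gt0.
have p0 : 0 <= p by rewrite pE mulr_ge0 ?(ltW s3V)//; lra.
have p2s : p <= 2 * s ^- 3 by rewrite pE mulrC ler_wpM2r ?(ltW s3V)//; lra.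
pose y := K * (J + K / 2) / s ^+ 3.
have -> : - (K * J / s ^+ 3 + K ^+ 2 / (2 * s ^+ 3) + K * (2 * U ^+ 2)) + K
    + (K * (x - 2 * x ^+ 2) - 2^-1) + (- p - 2 * p ^+ 2) * M =
  - (2 * (K * U ^+ 2)) - 2 * (K * x ^+ 2) - 2^-1 + x * y - 2 * (p ^+ 2 * M).
  have pM : p * M = (1 + x) * (K - y) by rewrite pE /M /y; field; lra.
  have -> : (- p - 2 * p ^+ 2) * M = - (p * M) - 2 * (p ^+ 2 * M) by ring.
  by rewrite pM /y; field; lra.
have KU : K * U ^+ 2 <= b * Q ^+ 2.
  have -> : b * Q ^+ 2 = (b * s ^+ 2) * U ^+ 2 by rewrite Udef; field; lra.
  by rewrite ler_wpM2r ?sqr_ge0.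
have Kx : K * x ^+ 2 <= b * lambda ^+ 2.
  have -> : b * lambda ^+ 2 = (b * s ^+ 2) * x ^+ 2 by rewrite xE; field; lra.
  by rewrite ler_wpM2r ?sqr_ge0.
have y0 : 0 <= y.
  by rewrite /y divr_ge0 ?(ltW S3)// mulr_ge0 ?(ltW K0)//; lra.
have yle : y <= b * Q * s.
  rewrite /y ler_pdivrMr//.
  have -> : b * Q * s * s ^+ 3 = (b * s ^+ 2) * (Q * s ^+ 2) by ring.
  apply: ler_pM => //; lra.
have xy : - (`|lambda| * b * Q) <= x * y.
  have : `|x * y| <= `|lambda| * b * Q.
    rewrite normrM (ger0_norm y0) xE normrM normfV (gtr0_norm s0).
    have -> : `|lambda| * b * Q = `|lambda| / s * (b * Q * s) by field; lra.
    by rewrite ler_wpM2l// divr_ge0 ?(ltW s0).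
  by rewrite ler_norml => /andP[].
have pM : p ^+ 2 * M <= 4 * b.
  have MK : M <= K * s ^+ 3.
    rewrite /M; have := sqr_ge0 K; have := mulr_ge0 (ltW K0) J0; lra.
  have p2 : p ^+ 2 <= (2 * s ^- 3) ^+ 2 by rewrite lerXn2r ?nnegrE// (le_trans p0).
  apply: le_trans (ler_pM (sqr_ge0 p) M0 p2 MK) _.
  have -> : (2 * s ^- 3) ^+ 2 * (K * s ^+ 3) = 4 * K / s ^+ 3 by field; lra.
  rewrite ler_pdivrMr//; have : b * s ^+ 2 <= b * s ^+ 3.
    by rewrite ler_pM2l// [leRHS]exprS ler_peMl ?(ltW S2)//; lra.
  lra.
lra.
Qed.

(** The expected number of tree components on [k] vertices is at least of order
[n `^ (- (2 / 3))], which is [s ^- 2], even after [O(n `^ (2 / 3))] vertices have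
been removed, with a loss at most exponential in [Q ^+ 2]. By [fact_le_stirling]
and the count of trees, the number of trees divided by [k`!] is of order
[expR k * k `^ (- (5 / 2))], that is [s ^- 5] apart from the exponential, and
[p ^+ k.-1] misses one factor [p], that is [s ^- 3], to balance [n ^+ k]. *)
Lemma tree_term_ge (n v k : nat) (s w0 lambda b Q : R) :
  let p := s ^- 3 + lambda * s ^- 4 in
  n%:R = s ^+ 3 -> 2 <= s -> 2 * `|lambda| <= s -> 2 * Q <= s ->
  0 < w0 -> 0 < b ->
  (v <= n)%N -> (0 < k)%N -> k%:R <= b * s ^+ 2 ->
  n%:R - v%:R + k%:R <= Q * s ^+ 2 ->
  w0 / 2 * (k%:R ^+ k / k%:R ^+ 2) <= (nb_connected k k.-1)%:R ->
  w0 / (2 * expR 1 * (Num.sqrt b * b ^+ 2)) * s ^- 2 *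
    expR (- (2 * b * Q ^+ 2 + 2 * b * lambda ^+ 2 + 2^-1 + 8 * b + `|lambda| * b * Q))
  <= tree_term p v k.
Proof.
move=> p; have pdef : p = s ^- 3 + lambda * s ^- 4 by []; clearbody p.
move=> ns s2 sl sQ w0p b0 vn k0 kb vkQ ck.
have s0 : 0 < s by lra.
have [x xE] : exists x, x = lambda / s by exists (lambda / s).
pose K : R := k%:R; pose J : R := n%:R - v%:R.
have K0 : 0 < K by rewrite ltr0n.
have J0 : 0 <= J by rewrite subr_ge0 ler_nat.
have S2 : 0 < s ^+ 2 by rewrite exprn_gt0.
have S3 : 0 < s ^+ 3 by rewrite exprn_gt0.
have [x1 x2] : - 2^-1 <= x /\ x <= 2^-1.
  have : `|x| <= 2^-1.
    by rewrite xE normrM normfV (gtr0_norm s0) ler_pdivrMr//; lra.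
  by rewrite ler_norml => /andP[].
have pE : p = s ^- 3 * (1 + x) by rewrite pdef xE; field; lra.
have s3 : s ^- 3 <= 8^-1.
  rewrite lef_pV2 ?posrE//; have : 2 ^+ 3 <= s ^+ 3 by rewrite lerXn2r ?nnegrE; lra.
  lra.
have p0 : 0 <= p by rewrite pE mulr_ge0 ?invr_ge0 ?(ltW S3)//; lra.
have p2s : p <= 2 * s ^- 3.
  by rewrite pE mulrC ler_wpM2r ?invr_ge0 ?(ltW S3)//; lra.
have ph : p <= 2^-1 by lra.
have [U Udef] : exists U, U = Q / s by exists (Q / s).
have n0 : (0 < n)%N by rewrite -(ltr0n R) ns.
have UE : (n%:R - v%:R + k%:R) / n%:R <= U.
  rewrite ler_pdivrMr ?ltr0n//.
  by have -> : U * n%:R = Q * s ^+ 2 by rewrite ns Udef; field; lra.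
have U2 : U <= 2^-1 by rewrite Udef ler_pdivrMr//; lra.
have kv : (k <= v)%N.
  have := le_trans UE U2; rewrite ler_pdivrMr ?ltr0n// => H.
  have : v%:R <= n%:R :> R by rewrite ler_nat.
  rewrite -(ler_nat R); lra.
(* The four factors of the term are bounded separately: the binomial
   coefficient (binge), the number of trees (ck), and the powers of p (pge) and
   1 - p (qge). *)
have ffa := ffact_ge_expR n0 vn U2 UE.
have fak := fact_le_stirling k0 (R := R).
pose E1 := K * J / n%:R + K ^+ 2 / (2 * n%:R) + K * (2 * U ^+ 2).
have sK0 : 0 < Num.sqrt K by rewrite sqrtr_gt0.
have den0 : 0 < expR 1 * Num.sqrt K * K ^+ k by rewrite !mulr_gt0 ?expR_gt0 ?exprn_gt0.
have binge : n%:R ^+ k * expR (- E1) * expR K / (expR 1 * Num.sqrt K * K ^+ k)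
    <= 'C(v, k)%:R.
  rewrite ler_pdivrMr//; apply: le_trans (ler_wpM2l _ fak) => //.
  by rewrite mulrA -natrM bin_ffact ler_wpM2r ?expR_ge0.
have pge : (s ^- 3) ^+ k.-1 * expR (K * (x - 2 * x ^+ 2) - 2^-1) <= p ^+ k.-1.
  rewrite pE exprMn ler_wpM2l ?exprn_ge0 ?invr_ge0 ?(ltW S3)//.
  apply: le_trans (expR_le1DxX _ x1); rewrite ler_expR.
  have -> : k.-1%:R = K - 1 by rewrite /K -[in RHS](prednK k0) -natr1 addrK.
  have : x - 2 * x ^+ 2 <= 2^-1 by have := sqr_ge0 x; lra.
  lra.
pose M := K * v%:R - K ^+ 2 / 2.
have Mle := bin2_sub_le kv; rewrite -/K -/M in Mle.
have M0 : 0 <= M by apply: le_trans Mle.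
have qge : expR ((- p - 2 * p ^+ 2) * M)
    <= (1 - p) ^+ ('C(v, 2) - 'C(v - k, 2) - k.-1).
  have pN : - 2^-1 <= - p by lra.
  apply: le_trans (expR_le1DxX _ pN); rewrite ler_expR sqrrN.
  have := sqr_ge0 p; set m := (_ - _ - _)%N in Mle *; nra.
have expo : - (2 * b * Q ^+ 2 + 2 * b * lambda ^+ 2 + 2^-1 + 8 * b + `|lambda| * b * Q)
   <= - E1 + K + (K * (x - 2 * x ^+ 2) - 2^-1) + (- p - 2 * p ^+ 2) * M.
  have vE : v%:R = s ^+ 3 - J by rewrite /J -ns; lra.
  rewrite /E1 ns Udef xE /M vE; apply: tree_exponent_ge => //; last by rewrite -vE.
  - by rewrite -xE.
  - lra.
  - by rewrite -xE; apply/andP; split; lra.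
rewrite /tree_term.
apply: le_trans (_ : n%:R ^+ k * expR (- E1) * expR K / (expR 1 * Num.sqrt K * K ^+ k) *
  (w0 / 2 * (K ^+ k / K ^+ 2) * ((s ^- 3) ^+ k.-1 * expR (K * (x - 2 * x ^+ 2) - 2^-1) *
    expR ((- p - 2 * p ^+ 2) * M))) <= _); last first.
  have a2 : 0 <= w0 / 2 * (K ^+ k / K ^+ 2).
    by rewrite mulr_ge0 ?divr_ge0 ?exprn_ge0 ?(ltW K0) ?(ltW w0p).
  have a3 : 0 <= (s ^- 3) ^+ k.-1 * expR (K * (x - 2 * x ^+ 2) - 2^-1).
    by rewrite mulr_ge0 ?expR_ge0 ?exprn_ge0 ?invr_ge0 ?(ltW S3).
  do 3?apply: ler_pM => //; rewrite ?expR_ge0//.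
  - by rewrite divr_ge0 ?(ltW den0)// !mulr_ge0 ?expR_ge0 ?exprn_ge0.
  - exact: mulr_ge0 a2 (mulr_ge0 a3 (expR_ge0 _)).
  - exact: mulr_ge0 a3 (expR_ge0 _).
have -> : n%:R ^+ k * expR (- E1) * expR K / (expR 1 * Num.sqrt K * K ^+ k) *
  (w0 / 2 * (K ^+ k / K ^+ 2) * ((s ^- 3) ^+ k.-1 * expR (K * (x - 2 * x ^+ 2) - 2^-1) *
    expR ((- p - 2 * p ^+ 2) * M))) =
  w0 / (2 * expR 1) * (s ^+ 3 / (Num.sqrt K * K ^+ 2)) *
    expR (- E1 + K + (K * (x - 2 * x ^+ 2) - 2^-1) + (- p - 2 * p ^+ 2) * M).
  rewrite !expRD ns -[in (s ^+ 3) ^+ k](prednK k0) [in LHS]exprSr exprVn.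
  have s3k : (s ^+ 3) ^+ k.-1 != 0 by rewrite !expf_neq0// gt_eqF.
  have Kk : K ^+ k != 0 by rewrite expf_neq0// gt_eqF.
  have e0 : expR 1 != 0 :> R by rewrite gt_eqF ?expR_gt0.
  move: (s3k) (Kk) (e0); set X := (s ^+ 3) ^+ k.-1; set Y := K ^+ k; set e := expR 1.
  move: (expR _) (expR _) (expR _) (expR _) (expR _) => e1 e2 e3 e4 e5 X0 Y0 E0.
  by field; rewrite X0 Y0 E0 gt_eqF// gt_eqF.
apply: ler_pM; rewrite ?expR_ge0 ?ler_expR//.
  rewrite mulr_ge0 ?divr_ge0 ?invr_ge0 ?(ltW w0p) ?(ltW S2)//.
  by rewrite !mulr_ge0 ?expR_ge0 ?sqrtr_ge0 ?sqr_ge0 ?(ltW b0).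
have sb0 : 0 < Num.sqrt b by rewrite sqrtr_gt0.
have -> : w0 / (2 * expR 1 * (Num.sqrt b * b ^+ 2)) * s ^- 2 =
  w0 / (2 * expR 1) * (s ^+ 3 / ((Num.sqrt b * s) * (b * s ^+ 2) ^+ 2)).
  by field; rewrite ?gt_eqF ?expR_gt0.
rewrite ler_wpM2l ?divr_ge0 ?mulr_ge0 ?expR_ge0 ?(ltW w0p)//.
rewrite ler_wpM2l ?(ltW S3)// lef_pV2 ?posrE ?mulr_gt0 ?exprn_gt0 ?mulr_gt0//.
apply: ler_pM; rewrite ?sqrtr_ge0 ?sqr_ge0//; last first.
  by rewrite lerXn2r ?nnegrE ?(ltW K0)// ltW// mulr_gt0.
rewrite -[X in _ * X](ger0_norm (ltW s0)) -sqrtr_sqr -sqrtrM ?(ltW b0)//.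
by rewrite ler_sqrt// mulr_ge0 ?(ltW b0) ?(ltW S2).
Qed.

End TreeTerm.

Section FactorialMoments.
Context {R : realType}.

(** Half of Wright's constant suffices, since constant factors only contribute a
power of a constant in the end; the quotient [k ^+ k / k ^+ 2] matches the
factor [k ^+ k] of Stirling's bound without real exponents. *)
Lemma wright_tree_lower_bound (w : nat -> R) : wright_constants w ->
  exists k0, forall k, (k0 <= k)%N -> (0 < k)%N ->
    w 0%N / 2 * (k%:R ^+ k / k%:R ^+ 2) <= (nb_connected k k.-1)%:R.
Proof.
move=> /(_ 0%N)[w0]; set u := fun k : nat => _ => ul.
have [k0 _ Hk0] : (\forall k \near \oo%classic, 2^-1 < u k)%classic.
  by apply: (cvgr_gt (1 : R)) ul _ _; lra.
exists k0 => k /Hk0 + k0'; rewrite /= /u addn0 subn1 mulr0n mulr0 mul0r addr0.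
have kR : 0 < k%:R :> R by rewrite ltr0n.
have -> : k%:R `^ (k%:R - 2) = k%:R ^+ k / k%:R ^+ 2 :> R.
  rewrite powRB; last by rewrite (gt_eqF kR) implybT.
  by rewrite !powR_mulrn ?ler0n.
have K0 : 0 < k%:R ^+ k / k%:R ^+ 2 :> R by rewrite divr_gt0 ?exprn_gt0.
by rewrite (ltr_pdivlMr _ _ (mulr_gt0 w0 K0)) => /ltW; rewrite mulrA [_^-1 * _]mulrC.
Qed.

(** The integers following the integer part of [a] are counted: rounding costs at
most 1, hence at most half of the length. *)
Lemma card_window (a b : R) (v : nat) : 0 < a -> a < b -> 2 <= b - a -> b <= v%:R ->
  (b - a) / 2 <= #|[set k : 'I_v.+1 | (a <= k%:R <= b)]|%:R.
Proof.
move=> a0 ab ba2 bv.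
pose m := (Num.truncn a).+1; pose N := Num.truncn (b - a).
have /andP[mlo mhi] := truncn_itv (ltW a0).
have ba0 : 0 <= b - a by lra.
have /andP[Nlo Nhi] := truncn_itv ba0.
have inb (i : 'I_N) : a <= (m + i)%:R <= b.
  rewrite natrD (le_trans (ltW mhi)) ?lerDl//=.
  have : i.+1%:R <= N%:R :> R by rewrite ler_nat.
  by rewrite /m -!natr1 -/N in mlo mhi Nlo Nhi * => iN; lra.
have iv (i : 'I_N) : (m + i < v.+1)%N.
  by rewrite ltnS -(ler_nat R); have /andP[_ H] := inb i; exact: le_trans bv.
pose f (i : 'I_N) : 'I_v.+1 := Ordinal (iv i).
have finj : injective f.
  by move=> i j /(congr1 val)/= /addnI ij; exact: val_inj.
apply: (@le_trans _ _ N%:R); first by rewrite -natr1 -/N in Nhi; lra.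
rewrite ler_nat -[leqLHS]card_ord -(card_imset _ finj).
apply/subset_leq_card/fintype.subsetP => _ /imsetP[i _ ->].
by rewrite inE /= inb.
Qed.

Lemma pcrit_cube_root (lambda : R) (n : nat) :
  pcrit lambda n = (n%:R `^ 3^-1) ^- 3 + lambda * (n%:R `^ 3^-1) ^- 4.
Proof.
rewrite /pcrit -!powR_invn ?powR_ge0// -!powRrM.
have -> : 3^-1 * - 3%:R = - 1 :> R by field.
have -> : 3^-1 * - 4%:R = - (4 / 3) :> R by field.
by rewrite powR_inv1.
Qed.

(** Every step of the peeling sums at least [(b - a) / 2 * s ^+ 2] terms of order
[s ^- 2], so it gains a factor bounded below independently of [n], the loss
being [expR (- (B * q ^+ 2))] as [q] components have at most
[q * b * n `^ (2 / 3)] vertices; [q] steps give the cube. *)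
Lemma Xi_factorial_moment_ge (w : nat -> R) (lambda a b : R) (R0 : nat) :
    wright_constants w -> 0 < a -> a < b ->
  exists delta B : R, [/\ 0 < delta, 0 < B & forall q, (0 < q)%N ->
    exists n0, forall n, (n0 <= n)%N -> 0 < pcrit lambda n < 1 ->
      delta ^+ q * expR (- (B * q%:R ^+ 3)) <=
      Xi_factorial_moment lambda n q (Kset a b R0)].
Proof.
move=> hw a0 ab; have [k0 Hk0] := wright_tree_lower_bound hw.
have [w0 _] := hw 0%N; have b0 : 0 < b by exact: lt_trans ab.
pose delta0 := w 0%N / (2 * expR 1 * (Num.sqrt b * b ^+ 2)).
have delta00 : 0 < delta0.
  by rewrite /delta0 divr_gt0// !mulr_gt0 ?expR_gt0 ?sqrtr_gt0 ?exprn_gt0.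
pose B := 8 * b ^+ 3 + 2 * b * lambda ^+ 2 + 2^-1 + 8 * b + 2 * `|lambda| * b ^+ 2.
have bl : 0 <= b * lambda ^+ 2 by rewrite mulr_ge0 ?sqr_ge0 ?ltW.
have lb : 0 <= `|lambda| * b ^+ 2 by rewrite mulr_ge0 ?sqr_ge0.
have b3 : 0 < b ^+ 3 by rewrite exprn_gt0.
have B0 : 0 < B by rewrite /B -!mulrA; lra.
exists (delta0 * ((b - a) / 2)), B; split=> //.
  by rewrite mulr_gt0// divr_gt0// subr_gt0.
(* q.+1 rather than q: the removed components and the current one are
   counted together. *)
move=> q q0; pose Q := q.+1%:R * b.
have q1 : 1 <= q%:R :> R by rewrite ler1n.
have Q0 : 0 < Q by rewrite mulr_gt0.
have QE : Q <= 2 * q%:R * b by rewrite /Q ler_pM2r// -natr1; lra.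
(* All the largeness conditions on the cube root of n are collected in S. *)
pose S := 2 + 2 * `|lambda| + 2 * Q + k0%:R / a + 2 / (b - a).
have ka0 : 0 <= k0%:R / a by rewrite divr_ge0 ?(ltW a0).
have ba0 : 0 < 2 / (b - a) by rewrite divr_gt0 ?subr_gt0.
have lam0 := normr_ge0 lambda.
exists (Num.truncn (S ^+ 3)).+1 => n nS pn.
pose s : R := n%:R `^ 3^-1.
have s0 : 0 <= s by exact: powR_ge0.
have ns : n%:R = s ^+ 3.
  by rewrite /s -powR_mulrn ?powR_ge0// -powRrM mulVf// powRr1.
have sS : S <= s.
  have S0 : 0 <= S by rewrite /S; lra.
  rewrite -(@ler_pXn2r _ 3)// -ns; apply: ltW.
  have /andP[_ H] := truncn_itv (exprn_ge0 3 S0).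
  by apply: lt_le_trans H _; rewrite ler_nat.
have s1 : 1 <= s by rewrite /S in sS; lra.
have ss2 : s <= s ^+ 2 by rewrite expr2 ler_peMl.
have s2gt0 : 0 < s ^+ 2 by lra.
have p01 : 0 <= pcrit lambda n <= 1 by case/andP: pn => /ltW-> /ltW->.
apply: le_trans (moment_le_Xi_factorial_moment q (Kset a b R0) p01).
set W := fun k : nat => _.
have WE k : W k = (a * s ^+ 2 <= k%:R <= b * s ^+ 2).
  have -> : W k = (a <= n%:R `^ (- (2 / 3)) * k%:R <= b).
    apply/idP/idP => [/set_mem[]|kab]; first by rewrite /= in_itv.
    by apply/mem_set; split => //=; rewrite in_itv.
  have -> : n%:R `^ (- (2 / 3)) = s ^- 2 :> R.
    rewrite /s -powR_invn ?powR_ge0// -powRrM; congr (_ `^ _); by field.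
  by rewrite mulrC ler_pdivlMr// ler_pdivrMr.
have bs0 : 0 <= b * s ^+ 2 by rewrite mulr_ge0 ?ltW.
have /andP[kmlo kmhi] := truncn_itv bs0.
set kmax := Num.truncn (b * s ^+ 2) in kmlo kmhi *.
have qk : q%:R * kmax%:R <= q%:R * b * s ^+ 2 by rewrite -mulrA ler_pM2l// ltr0n.
have QS : 2 * Q <= s by rewrite /S in sS; lra.
have Qs2 : 2 * (Q * s ^+ 2) <= s ^+ 3 by rewrite mulrA [leRHS]exprS ler_pM2r.
have Qs2E : Q * s ^+ 2 = q%:R * b * s ^+ 2 + b * s ^+ 2 by rewrite /Q -natr1; ring.
have qbs0 : 0 <= q%:R * b * s ^+ 2 by rewrite -mulrA mulr_ge0.
have qkn : (q * kmax <= n)%N.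
  rewrite -(ler_nat R) natrM ns; lra.
pose L := delta0 * ((b - a) / 2) * expR (- (B * q%:R ^+ 2)).
have -> : (delta0 * ((b - a) / 2)) ^+ q * expR (- (B * q%:R ^+ 3)) = L ^+ q.
  by rewrite /L [RHS]exprMn -expRM_natl; congr (_ * expR _); ring.
apply: (@moment_lower_bound _ _ p01 n W kmax (n - q * kmax) L).
- apply: mulr_ge0; last exact: expR_ge0.
  by apply/ltW; rewrite mulr_gt0// divr_gt0// subr_gt0.
- move=> k; rewrite WE => /andP[_ kb].
  rewrite -ltnS -(ltr_nat R); exact: le_lt_trans kmhi.
- move=> v /andP[v0 vn].
  have vR : n%:R - v%:R <= q%:R * b * s ^+ 2.
    apply: le_trans qk; rewrite lerBlDr -natrM -natrD ler_nat.
    by rewrite -leq_subLR.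
  pose t : R := delta0 * s ^- 2 * expR (- (B * q%:R ^+ 2)).
  have tge k : W k -> t <= tree_term (pcrit lambda n) v k.
    rewrite WE => /andP[ka kb].
    have kk0 : (k0 <= k)%N.
      rewrite -(ler_nat R); apply: le_trans ka.
      rewrite mulrC -ler_pdivrMr//; rewrite /S in sS; lra.
    have k0' : (0 < k)%N.
      by rewrite -(ltr0n R); apply: lt_le_trans ka; rewrite mulr_gt0.
    rewrite pcrit_cube_root -/s.
    apply: le_trans (tree_term_ge (Q := Q) (lambda := lambda) ns _ _ QS w0 b0 vn
      k0' kb _ (Hk0 _ kk0 k0')).
    + rewrite /t -/delta0; apply: ler_wpM2l; first by rewrite ltW// divr_gt0.
      rewrite ler_expR lerN2 /B.
      have Q2 : Q ^+ 2 <= 4 * b ^+ 2 * q%:R ^+ 2.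
        have -> : 4 * b ^+ 2 * q%:R ^+ 2 = (2 * q%:R * b) ^+ 2 by ring.
        by rewrite lerXn2r ?nnegrE ?(ltW Q0)// !mulr_ge0// ltW.
      have q2 : 1 <= q%:R ^+ 2 :> R by exact: exprn_ege1.
      have qq2 : q%:R <= q%:R ^+ 2 :> R by rewrite expr2 ler_peMl.
      have h1 : b * Q ^+ 2 <= 4 * b ^+ 3 * q%:R ^+ 2.
        have -> : 4 * b ^+ 3 * q%:R ^+ 2 = b * (4 * b ^+ 2 * q%:R ^+ 2) by ring.
        by rewrite ler_pM2l.
      have h2 : `|lambda| * b * Q <= 2 * (`|lambda| * b ^+ 2) * q%:R ^+ 2.
        apply: (@le_trans _ _ (`|lambda| * b * (2 * q%:R * b))).
          by rewrite ler_wpM2l// mulr_ge0// ltW.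
        have -> : `|lambda| * b * (2 * q%:R * b) = 2 * (`|lambda| * b ^+ 2) * q%:R by ring.
        by rewrite ler_wpM2l// mulr_ge0.
      have h3 : b * lambda ^+ 2 <= b * lambda ^+ 2 * q%:R ^+ 2 by rewrite ler_peMr.
      have h4 : b <= b * q%:R ^+ 2 by rewrite ler_peMr// ltW.
      lra.
    + by rewrite /S in sS; lra.
    + by rewrite /S in sS; lra.
    + by rewrite Qs2E; lra.
  apply: (@le_trans _ _ (\sum_(k < v.+1 | W k) t)); last by apply: ler_sum => k; exact: tge.
  rewrite (eq_bigl
    (mem [set k : 'I_v.+1 | (a * s ^+ 2 <= k%:R <= b * s ^+ 2)%R]%SET)); last first.
    by move=> k; rewrite /= finset.in_set; exact: WE.
  rewrite sumr_const -[leRHS]mulr_natl.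
  have as0 : 0 < a * s ^+ 2 by rewrite mulr_gt0.
  have absl : a * s ^+ 2 < b * s ^+ 2 by rewrite ltr_pM2r.
  have ab2 : 2 <= b * s ^+ 2 - a * s ^+ 2.
    by rewrite -mulrBl mulrC -ler_pdivrMr ?subr_gt0//; rewrite /S in sS; lra.
  have bv : b * s ^+ 2 <= v%:R by lra.
  have cW := card_window as0 absl ab2 bv.
  have t0 : 0 <= t by apply: mulr_ge0; [rewrite ltW// divr_gt0|exact: expR_ge0].
  apply: le_trans (ler_wpM2r t0 cW); rewrite /L /t le_eqVlt; apply/orP; left; apply/eqP.
  by field; lra.
- by rewrite subnK// cardsT card_ord.
Qed.

(** On the logarithmic scale the left side loses [c * q ^+ 3 * q `^ eps], and
[q `^ eps] eventually exceeds the constant [M] that would balance all the other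
terms, each of which is at most of order [q ^+ 3]. *)
Lemma no_faster_decay (delta B C c eps : R) :
    0 < delta -> 0 < B -> 0 < C -> 0 < c -> 0 < eps ->
  exists2 q : nat, (0 < q)%N &
    C ^+ q * expR (- (c * q%:R `^ (3 + eps))) < delta ^+ q * expR (- (B * q%:R ^+ 3)).
Proof.
move=> d0 B0 C0 c0 e0.
pose M := (B + `|ln C - ln delta|) / c.
have M0 : 0 <= M by rewrite divr_ge0 ?addr_ge0 ?(ltW B0) ?(ltW c0).
pose q := (Num.truncn ((M + 1) `^ eps^-1)).+1.
have q1 : 1 <= q%:R :> R by rewrite ler1n.
have Mq : M + 1 <= q%:R `^ eps.
  have -> : M + 1 = ((M + 1) `^ eps^-1) `^ eps.
    by rewrite -powRrM mulVf ?gt_eqF// powRr1//; lra.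
  rewrite ge0_ler_powR ?nnegrE ?powR_ge0 ?(ltW e0)//.
  by have /andP[_ /ltW] := truncn_itv (powR_ge0 (M + 1) eps^-1).
exists q => //.
have expln x : 0 < x -> x ^+ q = expR (q%:R * ln x) by move=> x0; rewrite expRM_natl lnK.
rewrite !expln// -!expRD ltr_expR powRD; last by rewrite gt_eqF ?implybT//; lra.
rewrite powR_mulrn; last by lra.
have q3 : 0 < q%:R ^+ 3 :> R by rewrite exprn_gt0//; lra.
have qq3 : q%:R <= q%:R ^+ 3 :> R by rewrite [leRHS]exprS ler_peMr// ?exprn_ege1//; lra.
have h1 : (B + `|ln C - ln delta| + c) * q%:R ^+ 3 <= c * (q%:R ^+ 3 * q%:R `^ eps).
  have -> : B + `|ln C - ln delta| + c = c * (M + 1) by rewrite /M; field; lra.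
  by rewrite -mulrA ler_pM2l// mulrC ler_pM2l.
have h2 : q%:R * (ln C - ln delta) <= `|ln C - ln delta| * q%:R ^+ 3.
  apply: (@le_trans _ _ (q%:R * `|ln C - ln delta|)).
    by rewrite ler_wpM2l ?ler_norm//; lra.
  by rewrite mulrC ler_wpM2l.
have h3 : 0 < c * q%:R ^+ 3 by rewrite mulr_gt0.
lra.
Qed.

End FactorialMoments.

(** * The cubic rate is sharp *)

Unset Implicit Arguments.
Local Open Scope classical_set_scope.

Theorem proposition3p5 (R : realType) (w : nat -> R) (hw : wright_constants w)
    (lambda a b : R) (R0 : nat) (ha : 0 < a) (hab : a < b) :
  (exists Am Ap Bm Bp : R,
    [/\ 0 < Am, 0 < Ap, 0 < Bm & 0 < Bp] /\
    forall q : nat, (1 <= q)%N ->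
      ((Am ^+ q * expR (- (Bm * q%:R ^+ 3)))%:E
         <= alpha w lambda (tuple_set (Kset a b R0) q))%E /\
      (alpha w lambda (tuple_set (Kset a b R0) q)
         <= (Ap ^+ q * expR (- (Bp * q%:R ^+ 3)))%:E)%E) /\
  (forall nlambda : nat,
    (forall n : nat, (nlambda <= n)%N -> 0 < pcrit lambda n < 1) ->
    forall eps : R, 0 < eps ->
      ~ exists C c : R,
        [/\ 0 < C, 0 < c &
          forall q n : nat, (1 <= q)%N -> (nlambda <= n)%N ->
            Xi_factorial_moment lambda n q (Kset a b R0)
              <= C ^+ q * expR (- (c * q%:R `^ (3 + eps)))]).
Proof.
have w0 r : 0 < w r by have [] := hw r.
split; first exact: alpha_bounds.
move=> nlambda pn eps eps0 [C [c [C0 c0 upper]]].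
have [delta [B [delta0 B0 lower]]] := Xi_factorial_moment_ge lambda R0 hw ha hab.
have [q q0] := no_faster_decay delta0 B0 C0 c0 eps0.
have [n0 {}lower] := lower q q0; pose n := maxn n0 nlambda.
rewrite ltNge => /negP; apply; apply: le_trans (upper q n q0 (leq_maxr _ _)).
by apply: lower; [exact: leq_maxl|exact/pn/leq_maxr].
Qed.
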